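(* Let $(E,\tau)$ be a locally solid vector lattice, where $\tau$ is a Fatou topology. Let $\tau^\delta$ be the extension of $\tau$ to a Fatou topology on the Dedekind completion $E^\delta$ of $E$. The following are equivalent: (1) $\tau$ is locally solidly submetrisable; (2) $\tau^\delta$ is locally solidly submetrisable; (3) $\tau^\delta$ is locally interval complete solidly submetrisable; (4) $C_\tau=E$; (5) $C_{\tau^\delta}=E^\delta$. When $\tau$ is an o-Lebesgue topology, (1)–(5) are also equivalent to: (6) $E$ has the countable sup property.
   Context: All vector lattices are real and Archimedean; linear topologies are Hausdorff. A locally solid topology on a vector lattice is a linear topology such that zero has a neighbourhood basis of solid sets. Order convergence: $x_\alpha\to x$ in order if there is a net $y_\beta\downarrow0$ such that for each $\beta_0$ there is $\alpha_0$ with $|x_\alpha-x|\leq y_{\beta_0}$ for $\alpha\geq\alpha_0$. A set is order closed if it contains the order limits of its nets. A Fatou topology is a locally solid topology in which zero has a neighbourhood basis of order closed solid sets; an o-Lebesgue topology is a locally solid topology in which order convergent nets converge topologically to the same limit. For a Fatou topology $\tau$ on $E$ there is a unique Fatou topology $\tau^\delta$ on $E^\delta$ extending $\tau$. A locally solid topology on a vector lattice $G$ is solidly submetrisable if it is finer than some metrisable locally solid topology on $G$; it is locally solidly submetrisable if its restriction to each principal band $B_x$ ($x\in G$) is solidly submetrisable; it is locally interval complete solidly submetrisable if for every $x\in G^+$ there is a metrisable locally solid topology $\widetilde\tau_x$ on $B_x$, coarser than the restriction to $B_x$, such that every $\widetilde\tau_x$-Cauchy sequence in $[0,x]$ converges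 in $\widetilde\tau_x$ to an element of $[0,x]$. A sequence $(V_n)$ of neighbourhoods of zero is normal if $V_{n+1}+V_{n+1}\subseteq V_n$; the carrier $C_\tau$ is the union of the disjoint complements $N^{\mathrm d}$ where $N=\bigcap_n V_n$ ranges over intersections of normal sequences of solid $\tau$-neighbourhoods of zero. $E$ has the countable sup property if every subset with a supremum in $E$ contains an at most countable subset with the same supremum. *)

(* Defs.v *)
From HB Require Import structures.
From mathcomp Require Import all_boot all_order all_algebra.
From mathcomp Require Import boolp classical_sets functions cardinality reals.
Set Implicit Arguments. Unset Strict Implicit. Unset Printing Implicit Defensive.
Import Order.TTheory GRing.Theory Num.Theory.
Local Open Scope classical_set_scope.
Local Open Scope ring_scope.

Section VL.
Context {R : realType} {E : lmodType R} (lev : E -> E -> Prop).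

Definition is_sup (A : set E) (s : E) : Prop :=
  (forall a, A a -> lev a s) /\ (forall u, (forall a, A a -> lev a u) -> lev s u).
Definition is_inf (A : set E) (s : E) : Prop :=
  (forall a, A a -> lev s a) /\ (forall u, (forall a, A a -> lev u a) -> lev u s).

Record vector_lattice : Prop := {
  vl_refl : forall x, lev x x;
  vl_trans : forall x y z, lev x y -> lev y z -> lev x z;
  vl_antisym : forall x y, lev x y -> lev y x -> x = y;
  vl_add : forall x y z, lev x y -> lev (x + z) (y + z);
  vl_scale : forall (a : R) x y, 0 <= a -> lev x y -> lev (a *: x) (a *: y);
  vl_sup2 : forall x y, exists s, is_sup [set z | z = x \/ z = y] s;
  vl_archimedean : forall x y, (forall n : nat, lev (n%:R *: x) y) -> lev x 0 }.

Definition dedekind_complete : Prop :=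
  forall A : set E, A !=set0 -> (exists u, forall a, A a -> lev a u) ->
    exists s, is_sup A s.

Definition absv (x : E) : E := xget x [set s | is_sup [set z | z = x \/ z = - x] s].

Definition disj (x y : E) : Prop := is_inf [set z | z = absv x \/ z = absv y] 0.

Definition dcomp (A : set E) : set E := [set y | forall a, A a -> disj y a].

Definition band (x : E) : set E := dcomp (dcomp [set x]).

Definition interval0 (x : E) : set E := [set y | lev 0 y /\ lev y x].

(** solid subsets of a subspace S (S will be E itself or a band) *)
Definition solid_in (S W : set E) : Prop :=
  W `<=` S /\ forall x y, W x -> S y -> lev (absv y) (absv x) -> W y.

Definition directed (I : Type) (leI : I -> I -> Prop) : Prop :=
  (forall i, leI i i) /\ (forall i j k, leI i j -> leI j k -> leI i k) /\
  inhabited I /\ (forall i j, exists k, leI i k /\ leI j k).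

Definition order_conv (I : Type) (leI : I -> I -> Prop) (x : I -> E) (l : E) : Prop :=
  exists (J : Type) (leJ : J -> J -> Prop) (y : J -> E),
    directed leJ /\ (forall b b', leJ b b' -> lev (y b') (y b)) /\
    is_inf (range y) 0 /\
    forall b0, exists a0, forall a, leI a0 a -> lev (absv (x a - l)) (y b0).

Definition order_closed (A : set E) : Prop :=
  forall (I : Type) (leI : I -> I -> Prop) (x : I -> E) (l : E),
    directed leI -> (forall i, A (x i)) -> order_conv leI x l -> A l.

(** A (Hausdorff) linear topology on a linear subspace S of E, given by its
    filter N of neighbourhoods of zero (subsets of S). *)
Definition lin_top_on (S : set E) (N : set (set E)) : Prop :=
  N S /\
  (forall U, N U -> U `<=` S) /\
  (forall U V, N U -> U `<=` V -> V `<=` S -> N V) /\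
  (forall U V, N U -> N V -> N (U `&` V)) /\
  (forall U, N U -> U 0) /\
  (forall U x, N U -> S x -> exists2 e : R, 0 < e &
      forall t : R, `|t| <= e -> U (t *: x)) /\
  (forall U, N U -> exists W, [/\ N W, W `<=` U &
      forall (t : R) w, `|t| <= 1 -> W w -> W (t *: w)]) /\
  (forall U, N U -> exists W, N W /\ forall a b, W a -> W b -> U (a + b)) /\
  (forall x, S x -> x <> 0 -> exists U, N U /\ ~ U x).

Definition locally_solid_on (S : set E) (N : set (set E)) : Prop :=
  lin_top_on S N /\ forall U, N U -> exists W, [/\ N W, W `<=` U & solid_in S W].

Definition locally_solid (N : set (set E)) : Prop := locally_solid_on setT N.

Definition top_conv (N : set (set E)) (I : Type) (leI : I -> I -> Prop)
    (x : I -> E) (l : E) : Prop :=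
  forall U, N U -> exists a0, forall a, leI a0 a -> U (x a - l).

Definition fatou (N : set (set E)) : Prop :=
  locally_solid N /\
  forall U, N U -> exists W, [/\ N W, W `<=` U, solid_in setT W & order_closed W].

Definition o_lebesgue (N : set (set E)) : Prop :=
  locally_solid N /\
  forall (I : Type) (leI : I -> I -> Prop) (x : I -> E) (l : E),
    directed leI -> order_conv leI x l -> top_conv N leI x l.

Definition metrisable_on (S : set E) (N : set (set E)) : Prop :=
  exists d : E -> E -> R,
    (forall x y, S x -> S y -> 0 <= d x y) /\
    (forall x, S x -> d x x = 0) /\
    (forall x y, S x -> S y -> d x y = 0 -> x = y) /\
    (forall x y, S x -> S y -> d x y = d y x) /\
    (forall x y z, S x -> S y -> S z -> d x z <= d x y + d y z) /\
    (forall x (U : set E), S x -> U `<=` S ->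
       (N [set y | U (x + y)] <->
        exists2 e : R, 0 < e & forall y, S y -> d x y < e -> U y)).

Definition restr (S : set E) (N : set (set E)) : set (set E) :=
  [set V | V `<=` S /\ exists U, N U /\ U `&` S `<=` V].

Definition solidly_submetrisable_on (S : set E) (N : set (set E)) : Prop :=
  exists M, [/\ locally_solid_on S M, metrisable_on S M & M `<=` N].

Definition locally_solidly_submetrisable (N : set (set E)) : Prop :=
  forall x, solidly_submetrisable_on (band x) (restr (band x) N).

Definition cauchy_seq (M : set (set E)) (u : nat -> E) : Prop :=
  forall U, M U -> exists n0, forall m n, (n0 <= m)%N -> (n0 <= n)%N -> U (u m - u n).

Definition seq_conv (M : set (set E)) (u : nat -> E) (l : E) : Prop :=
  forall U, M U -> exists n0, forall n, (n0 <= n)%N -> U (u n - l).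

Definition locally_interval_complete_solidly_submetrisable (N : set (set E)) : Prop :=
  forall x, lev 0 x -> exists M,
    [/\ locally_solid_on (band x) M, metrisable_on (band x) M,
        M `<=` restr (band x) N &
        forall u : nat -> E, (forall n, interval0 x (u n)) -> cauchy_seq M u ->
          exists2 l, interval0 x l & seq_conv M u l].

Definition normal_solid_seq (N : set (set E)) (V : nat -> set E) : Prop :=
  (forall n, N (V n) /\ solid_in setT (V n)) /\
  (forall n a b, V n.+1 a -> V n.+1 b -> V n (a + b)).

Definition carrier (N : set (set E)) : set E :=
  [set x | exists V, normal_solid_seq N V /\ dcomp [set y | forall n, V n y] x].

Definition countable_sup_property : Prop :=
  forall (A : set E) s, is_sup A s ->
    exists C, [/\ C `<=` A, countable C & is_sup C s].

End VL.

Definition dedekind_completion {R : realType} {E F : lmodType R}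
  (lev : E -> E -> Prop) (levF : F -> F -> Prop) (j : E -> F) : Prop :=
  dedekind_complete levF /\
  (forall (a : R) x y, j (a *: x + y) = a *: j x + j y) /\
  injective j /\
  (forall x y, lev x y <-> levF (j x) (j y)) /\
  (forall x y s, is_sup lev [set z | z = x \/ z = y] s ->
                 is_sup levF [set z | z = j x \/ z = j y] (j s)) /\
  (forall f, levF 0 f -> f <> 0 ->
     exists x, [/\ levF 0 (j x), j x <> 0 & levF (j x) f]) /\
  (forall f, exists x, levF f (j x)).

Definition extends_top {R : realType} {E F : lmodType R} (j : E -> F)
  (N : set (set E)) (Nd : set (set F)) : Prop :=
  forall U, N U <-> exists W, Nd W /\ j @^-1` W `<=` U.

(* Main.v *)
(* Each condition is matched with the carrier. A normal sequence [V] of solid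
   neighbourhoods with [x] disjoint from its intersection induces on the band
   of [x] a Hausdorff locally solid topology with a countable base, hence
   (Birkhoff-Kakutani) a metrisable one; conversely the balls of a metrisable
   topology on the band contain the traces of such a sequence. Between [E] and
   its completion, normal sequences are pulled back along [j], and pushed
   forward using that [E] is order dense. If the topology is Fatou, the [V n]
   can be taken order closed; in a Dedekind complete lattice a Cauchy sequence
   in [[0, x]] then converges to its order limit inferior (along a rapidly
   converging subsequence). Order closedness also makes the carrier order dense,
   so that [x] is the supremum of the elements of the carrier in [[0, x]]; under
   the countable sup property countably many suffice, and countably many normal
   sequences have a common refinement. Finally, for an o-Lebesgue topology the
   finite suprema of a set with supremum [s] converge to [s], and a sequence of
   them chosen along [V], for [s - a0] in the carrier, already has supremum
   [s]. *)
Require Import Defs.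
From mathcomp Require Import all_boot all_order all_algebra.
From mathcomp Require Import boolp classical_sets functions cardinality reals.
From mathcomp Require Import lra.
Import Order.TTheory GRing.Theory Num.Theory.
Local Open Scope classical_set_scope.

Set Implicit Arguments.
Unset Strict Implicit.

Lemma exists_half_expr_lt (R : realType) (e : R) :
  (0 < e -> exists n, 2^-1 ^+ n < e)%R.
Proof.
move=> e0; exists (Num.bound e^-1).
rewrite exprVn invf_plt ?posrE ?exprn_gt0 //.
have := archi_boundP (ltW (_ : 0 < e^-1))%R; rewrite invr_gt0 => /(_ e0) h.
apply: (lt_trans h); rewrite -natrX ltr_nat; exact: ltn_expl.
Qed.

(** * Birkhoff-Kakutani metrisation of a countable base at zero in an abelian group *)

Section BirkhoffKakutani.
Local Open Scope ring_scope.
Variables (R : realType) (G : zmodType) (W : nat -> set G).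
Hypothesis WT : W 0 = setT.
Hypothesis W0 : forall n, W n 0.
Hypothesis WN : forall n x, W n x -> W n (- x).
Hypothesis WD3 : forall n x y z,
  W n.+1 x -> W n.+1 y -> W n.+1 z -> W n (x + y + z).

Lemma W_decreasing m n : (m <= n)%N -> W n `<=` W m.
Proof.
elim: n => [|n IH]; first by rewrite leqn0 => /eqP ->.
rewrite leq_eqVlt => /orP[/eqP -> //|lemn x Wx].
apply: IH => //; have := WD3 Wx (W0 n.+1) (W0 n.+1).
by rewrite !addr0.
Qed.

Let pw (n : nat) : R := 2^-1 ^+ n.

Let pw_gt0 n : 0 < pw n. Proof. by rewrite exprn_gt0 ?invr_gt0. Qed.

Let pwS n : pw n = pw n.+1 + pw n.+1.
Proof. by rewrite /pw exprS; lra. Qed.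

Let pw_lt m n : pw n < pw m -> (m < n)%N.
Proof.
move=> h; rewrite ltnNge; apply/negP => le_nm; move: h.
by rewrite ltNge ler_wiXn2l ?invr_ge0 // invf_le1 ?ler1n.
Qed.

Definition cost (l : seq (nat * G)) : R := \sum_(p <- l) pw p.1.

(** A link carries an index of its own because one element may lie in several [W n]; the infimum in
    [gnorm] picks the cheapest choice. *)
Definition chain (l : seq (nat * G)) (x : G) : Prop :=
  (forall p, p \in l -> W p.1 p.2) /\ x = \sum_(p <- l) p.2.

Let cost_ge0 l : 0 <= cost l.
Proof. by apply: sumr_ge0 => p _; exact/ltW/pw_gt0. Qed.

Let cost_split l (t : R) : 0 <= t -> t < cost l ->
  exists l1 p l2, [/\ l = l1 ++ p :: l2, cost l1 <= t & t < cost l1 + pw p.1].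
Proof.
rewrite /cost; elim: l t => [|p l IH] t t0; first by rewrite big_nil; lra.
rewrite big_cons => tlt; have [tp|pt] := ltP t (pw p.1).
  by exists [::], p, l; rewrite big_nil add0r.
have [||l1 [q [l2 [-> h1 h2]]]] := IH (t - pw p.1); [lra|lra|].
exists (p :: l1), q, l2; rewrite cat_cons big_cons; split => //; lra.
Qed.

(* Cut the chain where its cost reaches half of the total: both ends cost less
   than [pw m.+1], and so does the link at the cut. *)
Lemma chain_W l x m : chain l x -> cost l < pw m -> W m x.
Proof.
have [k] := ubnP (size l); elim: k l x m => // k IH l x m lk [Wl ->] cl.
have [c0|c0] := ltP 0 (cost l); last first.
  case: l Wl c0 {lk cl} => [|p l] _; first by rewrite big_nil.
  rewrite /cost big_cons; have := pw_gt0 p.1; have := cost_ge0 l.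
  by rewrite /cost; lra.
have [||l1 [p [l2 [el h1 h2]]]] := @cost_split l (cost l / 2); [lra|lra|].
have cE : cost l = cost l1 + pw p.1 + cost l2.
  by rewrite /cost el big_cat big_cons /= addrA.
have := pwS m; have := cost_ge0 l1; have := cost_ge0 l2 => c2 c1 pm.
have W1 : W m.+1 (\sum_(q <- l1) q.2).
  apply: (IH l1); [|split=> // q ql1|lra].
    by move: lk; rewrite el size_cat /= addnS ltnS; apply: leq_trans; rewrite ltnS leq_addr.
  by apply: Wl; rewrite el mem_cat ql1.
have W2 : W m.+1 (\sum_(q <- l2) q.2).
  apply: (IH l2); [|split=> // q ql2|lra].
    by move: lk; rewrite el size_cat /= addnS ltnS; apply: leq_trans; rewrite ltnS leq_addl.
  by apply: Wl; rewrite el mem_cat in_cons ql2 !orbT.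
have Wp : W m.+1 p.2.
  apply: (W_decreasing (pw_lt (_ : pw p.1 < pw m))); first lra.
  by apply: Wl; rewrite el mem_cat mem_head orbT.
by rewrite el big_cat big_cons /= addrA; exact: WD3.
Qed.

(** The Birkhoff-Kakutani pseudonorm. Since [W 0 = setT], every [x] has a one-link chain and the
    infimum is over a nonempty set. *)
Definition gnorm (x : G) : R := inf [set c | exists2 l, chain l x & c = cost l].

Let chain1 n x : W n x -> chain [:: (n, x)] x.
Proof.
by move=> Wx; split=> [p|]; rewrite ?big_seq1 // inE => /eqP ->.
Qed.

Let gnorm_has_inf x : has_inf [set c | exists2 l, chain l x & c = cost l].
Proof.
split; last by exists 0 => _ [l _ ->].
by eexists; exists [:: (0%N, x)] => //; apply: chain1; rewrite WT.
Qed.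

Let gnorm_le l x : chain l x -> gnorm x <= cost l.
Proof. by move=> h; apply: ge_inf; [case: (gnorm_has_inf x)|exists l]. Qed.

Let gnorm_approx x (e : R) : 0 < e -> exists2 l, chain l x & cost l < gnorm x + e.
Proof.
by move=> e0; have [_ [l h ->] hl] := inf_adherent e0 (gnorm_has_inf x); exists l.
Qed.

Lemma gnorm_ge0 x : 0 <= gnorm x.
Proof. by apply: lb_le_inf => [|_ [l _ ->] //]; case: (gnorm_has_inf x). Qed.

Lemma gnormD x y : gnorm (x + y) <= gnorm x + gnorm y.
Proof.
apply/ler_addgt0Pr => e e0.
have [|l1 [W1 ->] c1] := @gnorm_approx x (e / 2); first lra.
have [|l2 [W2 ->] c2] := @gnorm_approx y (e / 2); first lra.
have : chain (l1 ++ l2) (\sum_(p <- l1) p.2 + \sum_(p <- l2) p.2).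
  split; last by rewrite big_cat.
  by move=> p; rewrite mem_cat => /orP[/W1|/W2].
by move=> /gnorm_le; rewrite /cost big_cat -/(cost _) -/(cost _) /=; lra.
Qed.

Let gnormN_le x : gnorm (- x) <= gnorm x.
Proof.
apply/ler_addgt0Pr => e /(gnorm_approx x) [l [Wl ->] /ltW]; apply: le_trans.
have -> : cost l = cost [seq (p.1, - p.2) | p <- l] by rewrite /cost big_map.
apply: gnorm_le; split; last by rewrite big_map -sumrN.
by move=> _ /mapP[p pl ->] /=; exact/WN/Wl.
Qed.

Lemma gnormN x : gnorm (- x) = gnorm x.
Proof. by apply/le_anti; rewrite gnormN_le -{1}[x]opprK gnormN_le. Qed.

(** Some chain of [x] costs less than 2^-n, and [chain_W] applies to it. Together with [W_gnorm],
    this makes the balls of [gnorm] and the sets [W n] equivalent bases at zero. *)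
Lemma gnorm_W n : exists2 e : R, 0 < e & forall x, gnorm x < e -> W n x.
Proof.
exists (pw n); first exact: pw_gt0; move=> x xn.
have [|l h1 h2] := @gnorm_approx x (pw n - gnorm x); first lra.
by apply: chain_W h1 _; lra.
Qed.

Lemma W_gnorm (e : R) : 0 < e -> exists n, forall x, W n x -> gnorm x < e.
Proof.
move=> /exists_half_expr_lt[n ne]; exists n => x /chain1 /gnorm_le /le_lt_trans; apply.
by rewrite /cost big_seq1.
Qed.

Lemma gnorm0 : gnorm 0 = 0.
Proof.
apply/le_anti; rewrite gnorm_ge0 andbT.
by apply/ler_addgt0Pr => e /W_gnorm[n /(_ _ (W0 n))/ltW]; rewrite add0r.
Qed.

Lemma gnorm_eq0 x : gnorm x = 0 -> forall n, W n x.
Proof. by move=> x0 n; have [e e0] := gnorm_W n; apply; rewrite x0. Qed.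

End BirkhoffKakutani.

(** * Elementary calculus in a vector lattice *)

Section VectorLattice.
Local Open Scope ring_scope.
Context {R : realType} {E : lmodType R} (lev : E -> E -> Prop).
Hypothesis hE : vector_lattice lev.
Local Notation "x ≼ y" := (lev x y) (at level 70, no associativity).

Lemma lev_refl x : x ≼ x. Proof. exact: vl_refl. Qed.
Local Hint Resolve lev_refl : core.

Lemma lev_trans y x z : x ≼ y -> y ≼ z -> x ≼ z.
Proof. exact: (vl_trans hE). Qed.

Lemma lev_anti x y : x ≼ y -> y ≼ x -> x = y.
Proof. exact: (vl_antisym hE). Qed.

Lemma levD x y z t : x ≼ y -> z ≼ t -> x + z ≼ y + t.
Proof.
move=> xy zt; apply: (@lev_trans (y + z)); first exact: (vl_add hE).
by rewrite ![y + _]addrC; exact: (vl_add hE).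
Qed.

(** An equality of propositions, so that [rewrite] can use it. *)
Lemma lev_subr_addr x y z : (x ≼ y - z) = (x + z ≼ y).
Proof.
apply/propext; split => h; first by rewrite -[y](subrK z); exact: levD.
by rewrite -[x](addrK z); exact: levD.
Qed.

Lemma lev_subl_addr x y z : (x - y ≼ z) = (x ≼ z + y).
Proof. by rewrite -[in RHS](opprK y) lev_subr_addr. Qed.

Lemma lev_opp2 x y : (- x ≼ - y) = (y ≼ x).
Proof. by rewrite -[- y]sub0r lev_subr_addr addrC lev_subl_addr add0r. Qed.

Lemma lev_subr_ge0 x y : (0 ≼ y - x) = (x ≼ y).
Proof. by rewrite lev_subr_addr add0r. Qed.

Lemma levZ (a : R) x y : 0 <= a -> x ≼ y -> a *: x ≼ a *: y.
Proof. exact: (vl_scale hE). Qed.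

Lemma levZ_ge0 (a : R) x : 0 <= a -> 0 ≼ x -> 0 ≼ a *: x.
Proof. by move=> a0 /(levZ a0); rewrite scaler0. Qed.

Lemma lev_archi x y : (forall n : nat, x *+ n ≼ y) -> x ≼ 0.
Proof.
by move=> h; apply: (vl_archimedean hE (y := y)) => n; rewrite scaler_nat.
Qed.

Lemma is_sup_unique A s t : is_sup lev A s -> is_sup lev A t -> s = t.
Proof. by move=> [h1 h2] [h3 h4]; apply: lev_anti; [exact: h2|exact: h4]. Qed.

Definition vjoin (x y : E) : E := xget 0 (is_sup lev [set z | z = x \/ z = y]).

(** Reflecting the join lets [lev_opp2] carry the laws of [vjoin] over to the meet. *)
Definition vmeet (x y : E) : E := - vjoin (- x) (- y).

Lemma vjoinP x y : is_sup lev [set z | z = x \/ z = y] (vjoin x y).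
Proof.
by have [s hs] := vl_sup2 hE x y; rewrite /vjoin; case: xgetP => [? -> //|/(_ s)].
Qed.

Lemma lev_joinl x y : x ≼ vjoin x y.
Proof. by apply: (vjoinP x y).1; left. Qed.

Lemma lev_joinr x y : y ≼ vjoin x y.
Proof. by apply: (vjoinP x y).1; right. Qed.

Lemma vjoin_le x y z : x ≼ z -> y ≼ z -> vjoin x y ≼ z.
Proof. by move=> xz yz; apply: (vjoinP x y).2 => _ [->|->]. Qed.

Lemma lev_meetl x y : vmeet x y ≼ x.
Proof. by rewrite -[x in _ ≼ x]opprK lev_opp2; exact: lev_joinl. Qed.

Lemma lev_meetr x y : vmeet x y ≼ y.
Proof. by rewrite -[y in _ ≼ y]opprK lev_opp2; exact: lev_joinr. Qed.

Lemma lev_meet x y z : z ≼ x -> z ≼ y -> z ≼ vmeet x y.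
Proof.
by move=> zx zy; rewrite -[z]opprK lev_opp2; apply: vjoin_le; rewrite lev_opp2.
Qed.

Lemma absvP x : is_sup lev [set z | z = x \/ z = - x] (absv lev x).
Proof.
by have [s hs] := vl_sup2 hE x (- x); rewrite /absv; case: xgetP => [? -> //|/(_ s)].
Qed.

Lemma lev_abs x : x ≼ absv lev x.
Proof. by apply: (absvP x).1; left. Qed.

Lemma levN_abs x : - x ≼ absv lev x.
Proof. by apply: (absvP x).1; right. Qed.

Lemma absv_le x z : x ≼ z -> - x ≼ z -> absv lev x ≼ z.
Proof. by move=> xz yz; apply: (absvP x).2 => _ [->|->]. Qed.

Lemma absv_ge0 x : 0 ≼ absv lev x.
Proof.
(* The sum of x <= |x| and -x <= |x| is 0 <= 2|x|, which is then halved. *)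
have := levD (lev_abs x) (levN_abs x); rewrite subrr.
move=> /(levZ (_ : 0 <= 2^-1)); rewrite invr_ge0 ler0n => /(_ isT).
by rewrite scaler0 -mulr2n -scaler_nat scalerA mulVf ?scale1r// pnatr_eq0.
Qed.
Local Hint Resolve absv_ge0 : core.

Lemma absv_id x : 0 ≼ x -> absv lev x = x.
Proof.
move=> x0; apply: lev_anti (lev_abs x); apply: absv_le => //.
by apply: lev_trans (x0); rewrite -[0]oppr0 lev_opp2.
Qed.

Lemma absv0 : absv lev 0 = 0. Proof. exact: absv_id. Qed.

Lemma absv_absv x : absv lev (absv lev x) = absv lev x.
Proof. exact: absv_id. Qed.

Lemma absvN x : absv lev (- x) = absv lev x.
Proof.
have h y : absv lev (- y) ≼ absv lev y.
  by apply: absv_le; rewrite ?opprK; [exact: levN_abs|exact: lev_abs].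
by apply: lev_anti; [exact: h|rewrite -{1}[x]opprK; exact: h].
Qed.

Lemma absv_triangle x y : absv lev (x + y) ≼ absv lev x + absv lev y.
Proof.
by apply: absv_le; rewrite ?opprD; apply: levD; first [exact: lev_abs|exact: levN_abs].
Qed.

Lemma absvZ_le (a b : R) x : `|a|%R <= b -> absv lev (a *: x) ≼ b *: absv lev x.
Proof.
rewrite ler_norml => /andP[ba ab].
have {ba}ab' : - a <= b by rewrite -[b]opprK lerN2.
suff h (c : R) : c <= b -> - c <= b -> c *: x ≼ b *: absv lev x.
  by apply: absv_le; rewrite -?scaleNr; apply: h; rewrite ?opprK.
move=> cb ncb; apply: (@lev_trans (`|c|%R *: absv lev x)).
  have [c0|c0] := leP 0 c; first by rewrite ger0_norm //; apply: levZ => //; exact: lev_abs.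
  rewrite ltr0_norm // -[x in x ≼ _]opprK -scalerN -scaleNr.
  by apply: levZ; [rewrite oppr_ge0 ltW|exact: levN_abs].
rewrite -lev_subr_ge0 -scalerBl; apply: levZ_ge0 => //.
by rewrite subr_ge0 ler_norml cb andbT -[c]opprK lerN2.
Qed.

(** * Disjointness, disjoint complements, principal bands and solid sets *)

Lemma disjP x y : disj lev x y <->
  forall u, u ≼ absv lev x -> u ≼ absv lev y -> u ≼ 0.
Proof.
split=> [[_ h] u ux uy|h]; first by apply: h => _ [->|->].
split=> [_ [->|->] //|u hu]; apply: h; apply: hu; [by left|by right].
Qed.

Lemma disjC x y : disj lev x y -> disj lev y x.
Proof. by move=> /disjP h; apply/disjP => u ? ?; exact: h. Qed.

Lemma disj_self x : disj lev x x -> x = 0.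
Proof.
move=> /disjP /(_ _ (lev_refl _) (lev_refl _)) h.
apply: lev_anti; first exact: lev_trans (lev_abs x) h.
by rewrite -[x]opprK -[0]oppr0 lev_opp2; exact: lev_trans (levN_abs x) h.
Qed.

Lemma disj_le x y z : disj lev x y -> absv lev z ≼ absv lev x -> disj lev z y.
Proof.
by move=> /disjP h zx; apply/disjP => u uz; apply: h; exact: lev_trans zx.
Qed.

(* If [u <= |x| + |y|] and [u <= |z|], then [u - |y|] is below both [|x|] and
   [|z|], hence [u <= |y|]. *)
Lemma disjD x y z : disj lev x z -> disj lev y z -> disj lev (x + y) z.
Proof.
move=> /disjP xz /disjP yz; apply/disjP => u uxy uz; apply: (yz) => //.
rewrite -[absv lev y]add0r -lev_subl_addr; apply: xz; rewrite lev_subl_addr.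
  exact: lev_trans (absv_triangle x y).
by apply: lev_trans uz _; rewrite addrC -lev_subl_addr subrr.
Qed.

(** If u <= s and u <= |z|, then for each a in [A] the element a - (s - u) is below both a and |z|,
    hence below 0. So s - u is an upper bound of [A], which forces u <= 0. *)
Lemma disj_sup A s z : is_sup lev A s -> 0 ≼ s ->
  (forall a, A a -> 0 ≼ a /\ disj lev a z) -> disj lev s z.
Proof.
move=> [ub lub] s0 hA; apply/disjP => u; rewrite absv_id // => us uz.
suff : s ≼ s - u by rewrite lev_subr_addr addrC -lev_subr_addr subrr.
apply: lub => a Aa; have [a0 /disjP] := hA a Aa; rewrite absv_id // => az.
rewrite -lev_subr_ge0 -lev_opp2 oppr0 opprB; apply: az.
  by rewrite opprB addrA lev_subl_addr; apply: levD.
rewrite opprB addrA lev_subl_addr addrC; apply: levD => //; exact: ub.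
Qed.

Lemma dcomp0 A : dcomp lev A 0.
Proof. by move=> a _; apply/disjP => u; rewrite absv0. Qed.

Lemma dcompD A x y : dcomp lev A x -> dcomp lev A y -> dcomp lev A (x + y).
Proof. by move=> hx hy a Aa; apply: disjD; [exact: hx|exact: hy]. Qed.

Lemma dcomp_solid A : solid_in lev setT (dcomp lev A).
Proof. by split=> // x y hx _ yx a Aa; exact: disj_le (hx a Aa) yx. Qed.

Lemma dcompS A B : A `<=` B -> dcomp lev B `<=` dcomp lev A.
Proof. by move=> AB x hx a /AB; exact: hx. Qed.

Lemma band_self x : band lev x x.
Proof. by move=> a /(_ x erefl)/disjC. Qed.

Lemma disj_band x y z : disj lev x y -> band lev x z -> disj lev y z.
Proof. by move=> xy hz; apply/disjC/hz => _ ->; exact: disjC. Qed.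

(** Lets a condition on positive elements reach every principal band. *)
Lemma band_absv x : band lev (absv lev x) = band lev x.
Proof.
congr (dcomp lev _); apply/seteqP; split => y h _ ->; move: (h _ erefl) => /disjP hd;
  by apply/disjP; rewrite ?absv_absv in hd *.
Qed.

Lemma solidI S V : solid_in lev setT V -> solid_in lev S (V `&` S).
Proof.
move=> [_ sV]; split=> [x []//|x y [Vx _] Sy yx]; split=> //.
exact: sV Vx _ yx.
Qed.

Lemma solidN V x : solid_in lev setT V -> V x -> V (- x).
Proof. by move=> [_ sV] Vx; apply: sV Vx _ _ => //; rewrite absvN. Qed.

Lemma solidZ V (a : R) x : solid_in lev setT V -> `|a|%R <= 1 -> V x -> V (a *: x).
Proof.
move=> [_ sV] a1 Vx; apply: sV Vx _ _ => //.
by have := absvZ_le x a1; rewrite scale1r.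
Qed.

(** * The metrisable locally solid topology that a normal sequence induces on a solid subspace *)

Definition normal_filter (S : set E) (V : nat -> set E) : set (set E) :=
  [set U | U `<=` S /\ exists n, V n `&` S `<=` U].

Section OnSubspace.
Variables (S : set E) (V : nat -> set E).
Hypothesis solidS : solid_in lev setT S.
Hypothesis S0 : S 0.
Hypothesis SD : forall x y, S x -> S y -> S (x + y).
Hypothesis solidV : forall n, solid_in lev setT (V n).
Hypothesis normalV : forall n a b, V n.+1 a -> V n.+1 b -> V n (a + b).
Hypothesis absorbingV : forall n x, exists2 e : R, 0 < e &
  forall t : R, `|t| <= e -> V n (t *: x).
Hypothesis separatedV : forall x, S x -> (forall n, V n x) -> x = 0.

Let M := normal_filter S V.

Let V0 n : V n 0.
Proof.
have [e e0 he] := absorbingV n 0; rewrite -(scale0r (0 : E)); apply: he.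
by rewrite normr0 ltW.
Qed.

Let VS n : V n.+1 `<=` V n.
Proof. by move=> x Vx; rewrite -[x]addr0; exact: normalV. Qed.

Let V_decreasing m n : (m <= n)%N -> V n `<=` V m.
Proof.
elim: n => [|n IH]; first by rewrite leqn0 => /eqP ->.
by rewrite leq_eqVlt => /orP[/eqP -> //|lemn x /VS]; exact: IH.
Qed.

Lemma locally_solid_normal_filter : locally_solid_on lev S M.
Proof.
have M_VS n : M (V n `&` S) by split=> [x []//|]; exists n.
split; last first.
  move=> U [_ [n nU]]; exists (V n `&` S); split=> //; exact: solidI.
split; first by split=> //; exists 0%N => x [].
split; first by move=> U [].
split.
  by move=> U U' [_ [n nU]] UU' U'S; split=> //; exists n; exact: subset_trans UU'.
split.
  move=> U U' [US [m mU]] [_ [n nU']]; split; first by move=> x [/US].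
  exists (maxn m n) => x [Vx Sx]; split; [apply: mU|apply: nU']; split=> //;
    apply: V_decreasing Vx; [exact: leq_maxl|exact: leq_maxr].
split; first by move=> U [_ [n nU]]; exact: nU.
split.
  move=> U x [_ [n nU]] Sx; have [e e0 he] := absorbingV n x.
  exists (Num.min e 1); first by rewrite lt_min e0 ltr01.
  move=> t; rewrite le_min => /andP[te t1]; apply: nU; split; first exact: he.
  exact: solidZ.
split.
  move=> U [_ [n nU]]; exists (V n `&` S); split=> // t w t1 [Vw Sw].
  by split; exact: solidZ.
split.
  move=> U [_ [n nU]]; exists (V n.+1 `&` S); split=> // a b [Va Sa] [Vb Sb].
  by apply: nU; split; [exact: normalV|exact: SD].
move=> x Sx x0; have [n nVx] : exists n, ~ V n x.
  by apply/not_existsP => h; apply: x0; apply: separatedV => // n; exact: contrapT.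
by exists (V n `&` S); split=> // -[].
Qed.

Lemma metrisable_normal_filter : metrisable_on S M.
Proof.
(* Taking every second [V] turns the condition on sums of two into the condition on sums of three;
   the shift by one makes room for [W 0 = setT]. *)
pose W n := if n is k.+1 then V k.*2 `&` S else setT.
have W0 n : W n 0 by case: n.
have WN n x : W n x -> W n (- x) by case: n => //= n [? ?]; split; exact: solidN.
have WD3 n x y z : W n.+1 x -> W n.+1 y -> W n.+1 z -> W n (x + y + z).
  case: n => //= n [Vx Sx] [Vy Sy] [Vz Sz]; split; last by do 2?apply: SD.
  by apply: normalV; [exact: normalV|exact: VS].
have WT : W 0 = setT by [].
exists (fun x y => gnorm R W (x - y)); split; first by move=> *; exact: gnorm_ge0.
split; first by move=> x _; rewrite subrr; exact: gnorm0.
split.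
  move=> x y Sx Sy xy0; apply/eqP; rewrite -subr_eq0; apply/eqP.
  apply: separatedV => [|n]; first by apply: SD => //; exact: solidN.
  have [+ _] := gnorm_eq0 WT W0 WD3 xy0 n.+1.
  by apply: V_decreasing; rewrite -addnn leq_addr.
split; first by move=> x y _ _; rewrite -(gnormN R WT WN) opprB.
split.
  by move=> x y z _ _ _; have := gnormD R WT (x - y) (y - z); rewrite addrA subrK.
move=> x U Sx US; split.
  move=> [_ [n nU]]; have [e e0 he] := gnorm_W R WT W0 WD3 n.+1.
  exists e => // y Sy; rewrite -(gnormN R WT WN) opprB => /he[Vyx Syx].
  rewrite -[y](subrK x) addrC; apply: nU; split=> //.
  by apply: V_decreasing Vyx; rewrite -addnn leq_addr.
move=> [e e0 he]; split.
  move=> y /US Sxy; rewrite -[y](addKr x); apply: SD => //; exact: solidN.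
(* At index 0 the ball already contains everything, so the trace of any [V n] will do. *)
have [[|n] hn] := W_gnorm WT e0.
  by exists 0%N => y [_ Sy]; apply: he; [exact: SD|exact: hn].
exists n.*2 => y [Vy Sy]; apply: he; first exact: SD.
by apply: hn; rewrite opprD addNKr; exact: WN n.+1 _ _.
Qed.

End OnSubspace.

(** * Normal sequences and the carrier of a locally solid topology *)

Section InTopology.
Variable N : set (set E).
Hypothesis hN : locally_solid lev N.

(** By recursion: [h] halves the previous neighbourhood, the result is cut down by [W], and [g]
    shrinks it to a set with [P]. Keeping [P] abstract serves both solid sets and order closed solid
    sets. *)
Lemma exists_normal_seq (P : set E -> Prop) (W : nat -> set E) :
    (forall U, N U -> exists V, [/\ N V, V `<=` U & P V]) ->
    (forall n, N (W n)) ->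
  exists V : nat -> set E, [/\ forall n, N (V n) /\ P (V n),
    forall n a b, V n.+1 a -> V n.+1 b -> V n (a + b) &
    forall n, V n `<=` W n].
Proof.
move=> hP NW; have [[_ [_ [_ [NI [_ [_ [_ [Nadd _]]]]]]]] _] := hN.
have [g hg] : {g : set E -> set E & forall U, N U -> [/\ N (g U), g U `<=` U & P (g U)]}.
  apply: (@choice _ _ (fun U V => N U -> [/\ N V, V `<=` U & P V])) => U.
  by have [/hP[V ?]|?] := pselect (N U); [exists V|exists setT].
have [h hh] : {h : set E -> set E & forall U, N U ->
    N (h U) /\ forall a b, h U a -> h U b -> U (a + b)}.
  apply: (@choice _ _ (fun U V => N U ->
    N V /\ forall a b, V a -> V b -> U (a + b))) => U.
  by have [/Nadd[V ?]|?] := pselect (N U); [exists V|exists setT].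
pose fix V n := if n is k.+1 then g (h (V k) `&` W n) else g (W 0%N).
have NV n : N (V n).
  elim: n => [|n /hh[Nh _]] /=; first by have [] := hg _ (NW 0%N).
  by have [] := hg _ (NI _ _ Nh (NW n.+1)).
have NhW n : N (h (V n) `&` W n.+1) by apply: NI => //; have [] := hh _ (NV n).
exists V; split.
- by move=> n; split=> //; case: n => [|n] /=;
    [have [] := hg _ (NW 0%N)|have [] := hg _ (NhW n)].
- move=> n a b /=; have [_ sub _] := hg _ (NhW n) => /sub[ha _] /sub[hb _].
  by have [_ +] := hh _ (NV n); apply.
- move=> [|n] /=; first by have [] := hg _ (NW 0%N).
  by have [_ + _] := hg _ (NhW n) => /subset_trans; apply=> x [].
Qed.


Lemma nbhs_absorbing U x : N U ->
  exists2 e : R, 0 < e & forall t : R, `|t| <= e -> U (t *: x).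
Proof.
have [[_ [_ [_ [_ [_ [Nabs _]]]]]] _] := hN.
by move=> NU; exact: Nabs.
Qed.

Lemma exists_normal_solid_seq (W : nat -> set E) : (forall n, N (W n)) ->
  exists V, normal_solid_seq lev N V /\ forall n, V n `<=` W n.
Proof.
have [_ Nsol] := hN => NW.
by have [V [? ? ?]] := exists_normal_seq Nsol NW; exists V.
Qed.

Lemma normal_solid_seqS V n : normal_solid_seq lev N V -> V n.+1 `<=` V n.
Proof.
move=> [NV VD] x Vx; rewrite -[x]addr0; apply: VD => //.
by have [[_ [_ [_ [_ [N0 _]]]]] _] := hN; apply: N0; case: (NV n.+1).
Qed.

Lemma bigcap_normal_solid V : normal_solid_seq lev N V ->
  solid_in lev setT [set y | forall n, V n y].
Proof.
move=> [NV _]; split=> // x y Vx _ yx n.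
by have [_ [_ sV]] := NV n; exact: sV (Vx n) _ yx.
Qed.

Lemma bigcap_normalD V x y : normal_solid_seq lev N V ->
  (forall n, V n x) -> (forall n, V n y) -> forall n, V n (x + y).
Proof. by move=> [_ VD] Vx Vy n; exact: VD. Qed.

Lemma carrier_solid : solid_in lev setT (carrier lev N).
Proof.
split=> // x y [V [nV xV]] _ yx; exists V; split=> //.
by have [_ sol] := dcomp_solid [set y | forall n, V n y]; exact: sol xV _ yx.
Qed.

(** Such a [y] is disjoint from [x], hence from the whole band, hence from itself. This is what
    makes the induced topology on the band Hausdorff. *)
Lemma carrier_separates_band (V : nat -> set E) x y : dcomp lev [set y | forall n, V n y] x ->
  band lev x y -> (forall n, V n y) -> y = 0.
Proof.
by move=> xV xy Vy; apply: disj_self; exact: disj_band (xV _ Vy) xy.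
Qed.

Lemma band_normal_filter V x : normal_solid_seq lev N V ->
    dcomp lev [set y | forall n, V n y] x ->
  let M := normal_filter (band lev x) V in
  [/\ locally_solid_on lev (band lev x) M, metrisable_on (band lev x) M &
      M `<=` restr (band lev x) N].
Proof.
move=> [NV VD] xV; split; last by move=> U [US [n nU]]; split=> //; exists (V n);
  split=> //; case: (NV n).
- apply: locally_solid_normal_filter => //.
  + exact: dcomp_solid.
  + exact: dcomp0.
  + exact: dcompD.
  + by move=> n; case: (NV n).
  + by move=> n y; apply: nbhs_absorbing; case: (NV n).
  + by move=> y; exact: carrier_separates_band.
- apply: metrisable_normal_filter => //.
  + exact: dcomp_solid.
  + exact: dcomp0.
  + exact: dcompD.
  + by move=> n; case: (NV n).
  + by move=> n y; apply: nbhs_absorbing; case: (NV n).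
  + by move=> y; exact: carrier_separates_band.
Qed.

(** From right to left, [band_normal_filter] applies. From left to right, the trace of [W n] on the
    band lies in the ball of radius 2^-n about 0, and [V] refines [W]: a positive element below |x|
    and below |y|, with [y] in every [V n], is at distance 0 from 0. *)
Lemma submetrisable_band_carrier x :
  solidly_submetrisable_on lev (band lev x) (restr (band lev x) N) <->
  carrier lev N x.
Proof.
split; last by move=> [V [nV xV]]; exists (normal_filter (band lev x) V);
  exact: band_normal_filter.
move=> [M [_ [d [dge0 [_ [d0 [_ [_ dM]]]]]] MN]].
have B0 : band lev x 0 by exact: dcomp0.
pose U n := [set y | band lev x y /\ d 0 y < 2^-1 ^+ n].
have NU n : exists W, N W /\ W `&` band lev x `<=` U n.
  have /MN[_ //] : M (U n).
  have -> : U n = [set y | U n (0 + y)].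
    by apply/seteqP; split=> y /=; rewrite add0r.
  apply/dM => //; first by move=> y [].
  by exists (2^-1 ^+ n); rewrite ?exprn_gt0 ?invr_gt0.
have [W hW] := choice NU.
have [V [nV VW]] := exists_normal_solid_seq (fun n => (hW n).1).
exists V; split=> // y Vy; apply/disjP => u ux uy.
(* The lower bound [u] need not be positive; its positive part is still below |x| and |y|, hence in
   the band and in every [V n]. *)
pose v := vjoin u 0; have v0 : 0 ≼ v by exact: lev_joinr.
have vx : v ≼ absv lev x by exact: vjoin_le.
have vy : v ≼ absv lev y by exact: vjoin_le.
have Bv : band lev x v.
  have [_ sol] := dcomp_solid (dcomp lev [set x]).
  by apply: (sol x v (@band_self x)) => //; rewrite absv_id.
suff <- : v = 0 by exact: lev_joinl.
symmetry; apply: d0 => //; apply/eqP; rewrite eq_le dge0 // andbT leNgt.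
apply/negP => /exists_half_expr_lt[n]; apply/negP; rewrite -leNgt ltW //.
have [_ /(_ v)[]//] := hW n; split=> //; apply: VW.
have [_ [_ sV]] := nV.1 n; apply: sV (Vy n) _ _ => //.
by rewrite absv_id.
Qed.

End InTopology.

(** * Order convergence of increasing nets, order closed sets and Fatou topologies *)

Lemma sup_order_conv (I : Type) (leI : I -> I -> Prop) (x : I -> E) t :
  directed leI -> (forall i k, leI i k -> x i ≼ x k) ->
  is_sup lev (range x) t -> order_conv lev leI x t.
Proof.
(* The differences [t - x i] serve as dominating net: if u is below all of them, t - u bounds the
   net from above, so u <= 0. *)
move=> dirI xmono [ub lub]; exists I, leI, (fun i => t - x i); split=> //.
have xt i : x i ≼ t by apply: ub; exists i.
split; first by move=> i k /xmono ik; apply: levD => //; rewrite lev_opp2.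
split; first split.
- by move=> _ [i _ <-]; rewrite lev_subr_ge0.
- move=> u hu; suff : t ≼ t - u by rewrite lev_subr_addr addrC -lev_subr_addr subrr.
  apply: lub => _ [i _ <-]; rewrite lev_subr_addr addrC -lev_subr_addr.
  by apply: hu; exists i.
- move=> i0; exists i0 => i /xmono ii; rewrite -absvN opprB absv_id ?lev_subr_ge0 //.
  by apply: levD => //; rewrite lev_opp2.
Qed.

Lemma order_closed_sup V (I : Type) (leI : I -> I -> Prop) (x : I -> E) t :
  order_closed lev V -> directed leI -> (forall i k, leI i k -> x i ≼ x k) ->
  is_sup lev (range x) t -> (forall i, V (x i)) -> V t.
Proof.
by move=> clV dirI xmono xt Vx; apply: (clV _ _ _ _ dirI Vx); exact: sup_order_conv.
Qed.

Lemma exists_normal_fatou_seq N (W : nat -> set E) :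
    fatou lev N -> (forall n, N (W n)) ->
  exists V, [/\ normal_solid_seq lev N V, forall n, order_closed lev (V n) &
    forall n, V n `<=` W n].
Proof.
move=> [hN fN] NW.
have fN' U : N U -> exists V, [/\ N V, V `<=` U & solid_in lev setT V /\ order_closed lev V].
  by move=> /fN[V [? ? ? ?]]; exists V.
have [V [NV VD VW]] := exists_normal_seq hN fN' NW.
exists V; split=> // [|n]; last by have [_ []] := NV n.
by split=> // n; have [? []] := NV n.
Qed.

(** The sequence [s] may have no supremum. Its meets with [t] stay in [V] by solidity and increase
    to [t], so order closedness applies to them. *)
Lemma order_closed_capped_sup V t (s : nat -> E) :
    solid_in lev setT V -> order_closed lev V ->
    (forall p, V (s p)) -> (forall p, 0 ≼ s p) -> (forall p, s p ≼ s p.+1) ->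
    0 ≼ t -> (forall u, (forall p, vmeet t (s p) ≼ u) -> t ≼ u) ->
  V t.
Proof.
move=> [_ sV] clV Vs s0 smono t0 tsup.
apply: (order_closed_sup (leI := fun m n : nat => (m <= n)%N)
  (x := fun p => vmeet t (s p)) clV).
- split=> //; split; first by move=> i k m; exact: leq_trans.
  split; first exact: (inhabits 0%N).
  by move=> i k; exists (maxn i k); rewrite leq_maxl leq_maxr.
- move=> i k ik; apply: lev_meet; first exact: lev_meetl.
  apply: (lev_trans (lev_meetr _ _)).
  elim: k ik => [|k IH]; first by rewrite leqn0 => /eqP ->.
  by rewrite leq_eqVlt => /orP[/eqP -> //|/IH h]; exact: lev_trans h _.
- split; first by move=> _ [p _ <-]; exact: lev_meetl.
  by move=> u hu; apply: tsup => p; apply: hu; exists p.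
- move=> p; apply: sV (Vs p) _ _ => //.
  by rewrite !absv_id //; [exact: lev_meetr|exact: lev_meet].
Qed.

(** * Completeness of order intervals in a Dedekind complete lattice *)

Fixpoint variation (w : nat -> E) (k q : nat) : E :=
  if q is q'.+1 then absv lev (w k.+1 - w k) + variation w k.+1 q' else 0.

Lemma variation_ge0 w k q : 0 ≼ variation w k q.
Proof.
by elim: q k => //= q IH k; rewrite -[0]addr0; exact: levD.
Qed.

Lemma variationS w k q : variation w k q ≼ variation w k q.+1.
Proof.
elim: q k => [|q IH] k; first exact: variation_ge0.
by apply: levD => //; exact: IH.
Qed.

Lemma variation_dist w k q : absv lev (w (k + q)%N - w k) ≼ variation w k q.
Proof.
elim: q k => [|q IH] k; first by rewrite addn0 subrr absv0.
have := IH k.+1; rewrite addSnnS /= => h.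
apply: lev_trans (levD (lev_refl _) h).
by rewrite -{1}(subrK (w k.+1) (w (k + q.+1)%N)) -addrA addrC; exact: absv_triangle.
Qed.

(** Peeling off the first increment leaves two terms in [V k.+1], whatever the number of steps;
    their sum is in [V k]. *)
Lemma variation_mem V w k q :
    (forall n, V n 0) -> (forall n, solid_in lev setT (V n)) ->
    (forall n a b, V n.+1 a -> V n.+1 b -> V n (a + b)) ->
    (forall n, V n.+1 (w n.+1 - w n)) ->
  V k (variation w k q).
Proof.
move=> V0 sV VD Vw; elim: q k => [|q IH] k //=; apply: VD => //.
by have [_ s] := sV k.+1; apply: s (Vw k) _ _ => //; rewrite absv_absv.
Qed.

Lemma dedekind_inf A : dedekind_complete lev -> A !=set0 ->
  (exists u, forall a, A a -> u ≼ a) -> exists s, is_inf lev A s.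
Proof.
move=> dc [a Aa] [u hu].
have [||s [ub lub]] := dc [set x | A (- x)].
- by exists (- a); rewrite /= opprK.
- by exists (- u) => x /hu; rewrite -lev_opp2 opprK.
exists (- s); split.
  by move=> x Ax; rewrite -[x]opprK lev_opp2; apply: ub; rewrite /= opprK.
move=> v hv; rewrite -[v]opprK lev_opp2; apply: lub => x /hv.
by rewrite -lev_opp2 opprK.
Qed.

(* The limit is the order limit inferior; the variations of [w] from [k] on,
   which lie in [V k], control both [w k - inf_(m >= k) w m] and
   [(liminf w - w k)^+]. *)
Lemma liminf_interval V w x : dedekind_complete lev ->
    (forall n, V n 0) -> (forall n, solid_in lev setT (V n)) ->
    (forall n, order_closed lev (V n)) ->
    (forall n a b, V n.+1 a -> V n.+1 b -> V n (a + b)) ->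
    (forall n, V n.+1 (w n.+1 - w n)) ->
    (forall n, interval0 lev x (w n)) ->
  exists2 l, interval0 lev x l & forall k, V k (w k.+1 - l).
Proof.
move=> dc V0 sV clV VD Vw wx.
have hv k : exists v, is_inf lev (range (fun m => w (k + m)%N)) v.
  apply: dedekind_inf => //; first by exists (w (k + 0)%N), 0%N.
  by exists 0 => _ [m _ <-]; case: (wx (k + m)%N).
have [v vP] := choice hv.
have vw k m : v k ≼ w (k + m)%N by apply: (vP k).1; exists m.
have v_add k p : v p ≼ v (k + p)%N.
  apply: (vP (k + p)%N).2 => _ [m _ <-].
  by rewrite addnAC addnC.
have vx k : v k ≼ x by apply: lev_trans (vw k 0%N) _; case: (wx (k + 0)%N).
have [||l [ub lub]] := dc (range v); first by exists (v 0%N), 0%N.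
  by exists x => _ [k _ <-].
have vl k : v k ≼ l by apply: ub; exists k.
exists l.
  split; last by apply: lub => _ [k _ <-].
  apply: lev_trans (vl 0%N); apply: (vP 0%N).2 => _ [m _ <-].
  by case: (wx (0 + m)%N).
pose s k := variation w k.
have Vs k p : V k (s k p) by exact: variation_mem.
have V1 k : V k (w k - v k).
  apply: (@order_closed_capped_sup _ _ (s k)) => //.
  - by move=> p; exact: variation_ge0.
  - by move=> p; exact: variationS.
  - by rewrite lev_subr_ge0 -[k in w k]addn0.
  move=> u hu; rewrite lev_subl_addr addrC -lev_subl_addr; apply: (vP k).2 => _ [p _ <-].
  rewrite lev_subl_addr addrC -lev_subl_addr; apply: lev_trans (hu p).
  apply: lev_meet; first by apply: levD => //; rewrite lev_opp2.
  by apply: lev_trans (variation_dist w k p); rewrite -opprB; exact: levN_abs.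
have V2 k : V k (vjoin (l - w k) 0).
  apply: (@order_closed_capped_sup _ _ (s k)) => //.
  - by move=> p; exact: variation_ge0.
  - by move=> p; exact: variationS.
  - exact: lev_joinr.
  move=> u hu; apply: vjoin_le; last first.
    apply: lev_trans (hu 0%N); apply: lev_meet => //; exact: lev_joinr.
  rewrite lev_subl_addr; apply: lub => _ [p _ <-].
  apply: (lev_trans (v_add k p)); rewrite -lev_subl_addr; apply: lev_trans (hu p).
  apply: lev_meet.
    by apply: lev_trans (lev_joinl _ _); apply: levD.
  apply: lev_trans (variation_dist w k p); apply: lev_trans (lev_abs _).
  by apply: levD => //; rewrite -[X in _ ≼ w X]addn0.
(* With k.+1 in both estimates, |w - l| <= (w - v) + (l - w)^+ is a sum of two elements of [V k.+1],
   hence lies in [V k]. *)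
move=> k; have [_ sk] := sV k; apply: sk (VD _ _ _ (V1 k.+1) (V2 k.+1)) _ _ => //.
apply: lev_trans (lev_abs _); apply: absv_le.
  rewrite -[X in X ≼ _]addr0; apply: levD (lev_joinr _ _).
  by apply: levD => //; rewrite lev_opp2.
rewrite opprB -[X in X ≼ _]add0r; apply: levD (lev_joinl _ _).
by rewrite lev_subr_ge0 -[X in _ ≼ w X]addn0.
Qed.

Lemma interval0_band x y : 0 ≼ x -> interval0 lev x y -> band lev x y.
Proof.
move=> x0 [y0 yx]; have [_ sB] := dcomp_solid (dcomp lev [set x]).
by apply: (sB x y (@band_self x)) => //; rewrite !absv_id.
Qed.

Lemma carrier_interval_complete N x : fatou lev N -> dedekind_complete lev ->
    0 ≼ x -> carrier lev N x ->
  exists M, [/\ locally_solid_on lev (band lev x) M, metrisable_on (band lev x) M,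
    M `<=` restr (band lev x) N &
    forall u : nat -> E, (forall n, interval0 lev x (u n)) -> cauchy_seq M u ->
      exists2 l, interval0 lev x l & seq_conv M u l].
Proof.
move=> fN dc x0 [V' [nV' xV']]; have hN := fN.1.
(* Passing to an order closed refinement shrinks the intersection and enlarges its disjoint
   complement, so [x] stays in it. *)
have [V [nV clV VV']] := exists_normal_fatou_seq fN (fun n => (nV'.1 n).1).
have xV : dcomp lev [set y | forall n, V n y] x.
  by apply: dcompS xV' => y Vy n; exact: VV'.
have [lsM metM MN] := band_normal_filter hN nV xV.
exists (normal_filter (band lev x) V); split=> // u ux cu.
have V0 n : V n 0.
  have [[_ [_ [_ [_ [N0 _]]]]] _] := hN; apply: N0; exact: (nV.1 n).1.
have sV n : solid_in lev setT (V n) by exact: (nV.1 n).2.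
have VD := nV.2.
have hphi k : exists n0, forall m n, (n0 <= m)%N -> (n0 <= n)%N -> V k (u m - u n).
  have [|n0 hn0] := cu (V k `&` band lev x); first by split=> [y []//|]; exists k.
  by exists n0 => m n hm hn; case: (hn0 m n hm hn).
have [phi phiP] := choice hphi.
(* Partial sums give a nondecreasing sequence of indices that dominates [phi]. *)
pose psi k := (\sum_(i < k.+1) phi i)%N.
have phi_psi k : (phi k <= psi k)%N by rewrite /psi big_ord_recr leq_addl.
have psiS k : (psi k <= psi k.+1)%N by rewrite {2}/psi big_ord_recr leq_addr.
(* The shift in [psi k.+1] puts the n-th increment in [V n.+1], as [liminf_interval] requires. *)
have [|l lx hl] := liminf_interval (V := V) (w := fun k => u (psi k.+1)) dc V0 sV clV VD
   _ (fun k => ux (psi k.+1)).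
  move=> n; apply: phiP; first exact: leq_trans (psiS _).
  exact: phi_psi.
(* The difference u m - l is split at [u (psi n.+3)], the term of index n.+2 of the subsequence;
   both pieces lie in [V n.+1]. *)
exists l => // U [_ [n nU]]; exists (phi n.+1) => m hm; apply: nU; split.
  rewrite -[u m](subrK (u (psi n.+3))) -addrA; apply: VD; last exact: hl n.+1.
  apply: phiP => //; apply: leq_trans (phi_psi _) _.
  by apply: leq_trans (psiS _); exact: psiS.
have Bl : band lev x (- l).
  by apply: (solidN (V := band lev x)); [exact: dcomp_solid|exact: interval0_band].
exact: dcompD (interval0_band x0 (ux m)) Bl.
Qed.

(* If [v := w - vmeet u w] were nonzero it would dominate some nonzero [t] in [P],
   and all multiples of [t] would stay below [w]. *)
Lemma order_dense_sup P w :
    P 0 -> (forall x y, P x -> P y -> P (x + y)) -> 0 ≼ w ->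
    (forall v, 0 ≼ v -> v <> 0 -> v ≼ w ->
      exists t, [/\ P t, 0 ≼ t, t <> 0 & t ≼ v]) ->
  is_sup lev [set z | P z /\ interval0 lev w z] w.
Proof.
move=> P0 PD w0 dense; split; first by move=> z [_ []].
move=> u hu; pose z := vmeet u w.
have hz a : P a -> interval0 lev w a -> a ≼ z.
  by move=> Pa aw; apply: lev_meet; [exact: hu|case: aw].
have [wz0|wz0] := pselect (w - z = 0).
  by rewrite -[w](subrK z) wz0 add0r; exact: lev_meetl.
have [|||t [Pt t0 tn0 tv]] := dense (w - z) => //.
- by rewrite lev_subr_ge0; exact: lev_meetr.
- rewrite lev_subl_addr -[X in X ≼ _]addr0; apply: levD => //; exact: hz.
have ht n : P (t *+ n) /\ interval0 lev w (t *+ n).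
  elim: n => [|n [Ptn tnw]]; first by rewrite mulr0n; split=> //; split.
  rewrite mulrSr; split; first exact: PD.
  split; first by rewrite -[0]addr0; apply: levD => //; case: tnw.
  by rewrite -[w](subrK z) addrC; apply: levD => //; exact: hz.
case: tn0; apply: lev_anti => //; apply: (lev_archi (y := w)) => n.
by have [_ []] := ht n.
Qed.

(** Otherwise take an order closed normal [V] inside a neighbourhood that misses [w], with
    intersection [P]. No nonzero positive v <= w is disjoint from [P], so [w] is the supremum of the
    elements of [P] in [0, w], and order closedness puts [w] in [V 0]. *)
Lemma carrier_order_dense N w : fatou lev N -> 0 ≼ w -> w <> 0 ->
  exists t, [/\ carrier lev N t, 0 ≼ t, t <> 0 & t ≼ w].
Proof.
move=> fN w0 wn0; have hN := fN.1; apply: contrapT => nodense.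
have [[_ [_ [_ [_ [_ [_ [_ [_ sepN]]]]]]]] _] := hN.
have [U [NU Uw]] := sepN w I wn0.
have [V [nV clV VU]] := exists_normal_fatou_seq fN (fun _ => NU).
pose P := [set y | forall n, V n y].
have P0 : P 0.
  by move=> n; have [[_ [_ [_ [_ [N0 _]]]]] _] := hN; apply: N0; exact: (nV.1 n).1.
have sP := bigcap_normal_solid nV; have PD x y := @bigcap_normalD _ _ x y nV.
apply: Uw; apply: (VU 0%N).
have wsup : is_sup lev [set z | P z /\ interval0 lev w z] w.
  apply: order_dense_sup => // v v0 vn0 vw.
  have ncv : ~ dcomp lev P v.
    by move=> cv; apply: nodense; exists v; split=> //; exists V.
  have [a Pa nd] : exists2 a, P a & ~ disj lev v a.
    apply: contrapT => h; apply: ncv => a Pa; apply: contrapT => nd.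
    by apply: h; exists a.
  have [z [zv za nz0]] : exists z, [/\ z ≼ absv lev v, z ≼ absv lev a & ~ z ≼ 0].
    apply: contrapT => h; apply/nd/disjP => z zv za; apply: contrapT => nz.
    by apply: h; exists z.
  have z0 : 0 ≼ vjoin z 0 by exact: lev_joinr.
  exists (vjoin z 0); split=> //.
  - by apply: sP.2 Pa _ _ => //; rewrite absv_id //; exact: vjoin_le.
  - by move=> zE; apply: nz0; rewrite -zE; exact: lev_joinl.
  - by rewrite -(absv_id v0); exact: vjoin_le.
(* These elements, indexed by themselves, are directed: the join of two is at most their sum, and
   [P] is solid and closed under sums. *)
pose Q z := P z /\ interval0 lev w z; pose T := {z | Q z}.
apply: (@order_closed_sup _ T (fun a b => sval a ≼ sval b) sval) => //.
- split; first by move=> a; exact: lev_refl.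
  split; first by move=> a b c; exact: lev_trans.
  split; first by apply: inhabits; exists 0; split=> //; split.
  move=> [a [Pa [a0 aw]]] [b [Pb [b0 bw]]].
  have hab : Q (vjoin a b).
    have ab0 : 0 ≼ vjoin a b by apply: lev_trans a0 (lev_joinl _ _).
    split; last by split=> //; exact: vjoin_le.
    apply: sP.2 (PD _ _ Pa Pb) _ _ => //.
    rewrite (absv_id ab0); apply: lev_trans (lev_abs _); apply: vjoin_le.
      by rewrite -[X in X ≼ _]addr0; exact: levD.
    by rewrite -[X in X ≼ _]add0r; exact: levD.
  by exists (exist Q _ hab); split; [exact: lev_joinl|exact: lev_joinr].
- suff <- : [set z | P z /\ interval0 lev w z] = range (sval : T -> E) by [].
  apply/seteqP; split=> [z hz|_ [[z hz] _ <-] //]; by exists (exist Q z hz).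
- by move=> i; have [Pz _] := svalP i; exact: Pz.
Qed.

(** * Common refinements of normal sequences and the countable sup property *)

Section CountableIntersections.
Variable N : set (set E).
Hypothesis hN : locally_solid lev N.

Lemma normal_solid_seq_setT : normal_solid_seq lev N (fun=> setT).
Proof. by have [[NT _] _] := hN; split=> //. Qed.

(** A diagonal choice: the n-th set meets only [V 0 n] to [V n n], so it remains a neighbourhood. *)
Lemma countable_bigcap_normal (V : nat -> nat -> set E) :
  (forall k, normal_solid_seq lev N (V k)) ->
  exists W, normal_solid_seq lev N W /\
    forall y, (forall n, W n y) -> forall k n, V k n y.
Proof.
move=> nV; have [[NT [_ [_ [NI _]]]] _] := hN.
exists (fun n => [set y | forall k, (k <= n)%N -> V k n y]); split; last first.
  move=> y Wy k n; have := Wy (maxn k n) k (leq_maxl _ _).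
  have : (n <= maxn k n)%N by exact: leq_maxr.
  elim: (maxn k n) => [|m IH]; first by rewrite leqn0 => /eqP ->.
  rewrite leq_eqVlt => /orP[/eqP -> //|nm] /(normal_solid_seqS hN (nV k)).
  exact: IH.
split=> [n|n a b Wa Wb k kn]; last first.
  by apply: (nV k).2; [apply: Wa|apply: Wb]; exact: leqW.
split; last first.
  split=> // x y Wx _ yx k kn; have [_ [_ s]] := (nV k).1 n.
  exact: s (Wx k kn) _ yx.
suff h m : N [set y | forall k, (k < m)%N -> V k n y] by exact: (h n.+1).
elim: m => [|m IH].
  by have -> : [set y | forall k, (k < 0)%N -> V k n y] = setT by apply/seteqP.
have -> : [set y | forall k, (k < m.+1)%N -> V k n y] =
    [set y | forall k, (k < m)%N -> V k n y] `&` V m n.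
  apply/seteqP; split=> [y h|y [h1 h2] k].
    by split=> [k km|]; apply: h => //; exact: ltnW.
  by rewrite ltnS leq_eqVlt => /orP[/eqP -> //|]; exact: h1.
by apply: NI => //; exact: ((nV m).1 n).1.
Qed.

(** An injection of [C] into the naturals gives one normal sequence per index; an index that is not
    attained gets the constant sequence [setT]. *)
Lemma carrier_countable C : countable C -> C `<=` carrier lev N ->
  exists W, normal_solid_seq lev N W /\
    forall x, C x -> dcomp lev [set y | forall n, W n y] x.
Proof.
move=> /countable_injP[f finj] Ccar.
have hV k : exists V, normal_solid_seq lev N V /\
    forall x, C x -> f x = k -> dcomp lev [set y | forall n, V n y] x.
  have [[x [Cx fx]]|nx] := pselect (exists x, C x /\ f x = k); last first.
    exists (fun=> setT); split; first exact: normal_solid_seq_setT.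
    by move=> x Cx fx; case: nx; exists x.
  have [V [nV xV]] := Ccar x Cx; exists V; split=> // x' Cx' fx'.
  by rewrite (finj x' x) ?inE // fx' fx.
have [V VP] := choice hV.
have [W [nW WV]] := countable_bigcap_normal (fun k => (VP k).1).
exists W; split=> // x Cx; apply: dcompS ((VP (f x)).2 x Cx erefl) => y Wy n.
exact: WV.
Qed.

Lemma carrierD x y : carrier lev N x -> carrier lev N y -> carrier lev N (x + y).
Proof.
move=> Cx Cy.
have [||W [nW hW]] := @carrier_countable [set x; y].
- by apply: finite_set_countable; exact: finite_set2.
- by move=> _ [->|->].
by exists W; split=> //; apply: dcompD; apply: hW; [left|right].
Qed.

End CountableIntersections.

Lemma csp_carrier N : fatou lev N -> countable_sup_property lev ->
  carrier lev N = setT.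
Proof.
move=> fN csp; have hN := fN.1; apply/seteqP; split=> // x _.
suff h : carrier lev N (absv lev x).
  by apply: (carrier_solid N).2 h _ _ => //; rewrite absv_absv.
have [C0 CD] : carrier lev N 0 /\
    forall x y, carrier lev N x -> carrier lev N y -> carrier lev N (x + y).
  split; last by move=> *; exact: carrierD.
  exists (fun=> setT); split; [exact: normal_solid_seq_setT|exact: dcomp0].
have sup_x : is_sup lev [set z | carrier lev N z /\ interval0 lev (absv lev x) z]
    (absv lev x).
  by apply: order_dense_sup => // v v0 vn0 _; exact: carrier_order_dense.
have [C [CA cC supC]] := csp _ _ sup_x.
have [|W [nW hW]] := carrier_countable hN cC; first by move=> z /CA[].
exists W; split=> // y Wy; apply: (disj_sup supC) => // a Ca; split.
  by have [_ []] := CA a Ca.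
exact: hW.
Qed.

Lemma carrier_csp N : o_lebesgue lev N -> carrier lev N = setT ->
  countable_sup_property lev.
Proof.
move=> [hN leb] CT A s [ub lub].
(* An empty [A] is countable itself; otherwise [a0] serves as base point of the finite suprema. *)
have [A0|/set0P[a0 Aa0]] := eqVneq A set0.
  by exists A; split=> //; rewrite A0; exact: countable0.
(* The net of finite suprema is indexed by lists from [A]; starting the fold at [a0] gives the empty
   list a value. *)
pose Q (l : seq E) := forall a : E, a \in l -> A a; pose T := {l | Q l}.
pose F (t : T) := foldr vjoin a0 (sval t).
have F_ub (t : T) u : (forall a, a \in sval t -> a ≼ u) -> a0 ≼ u -> F t ≼ u.
  case: t => l Ql; rewrite /F /=; elim: l {Ql} => //= b l IH hu a0u.
  apply: vjoin_le; first exact/hu/mem_head.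
  by apply: IH => // a al; apply: hu; rewrite in_cons al orbT.
have le_F (t : T) a : a \in a0 :: sval t -> a ≼ F t.
  case: t => l Ql; rewrite /F /=; elim: l {Ql} => [|b l IH] /=.
    by rewrite inE => /eqP ->.
  rewrite !in_cons orbCA => /orP[/eqP ->|al]; first exact: lev_joinl.
  by apply: lev_trans (lev_joinr _ _); apply: IH; rewrite in_cons.
have dirT : directed (fun t t' : T => F t ≼ F t').
  split; first by move=> t; exact: lev_refl.
  split; first by move=> a b c; exact: lev_trans.
  split; first by apply: inhabits; exists [::].
  move=> t t'; have hl a : a \in sval t ++ sval t' -> A a.
    by rewrite mem_cat => /orP[/(svalP t)|/(svalP t')].
  exists (exist Q _ hl); split; apply: F_ub => [a al|]; apply: le_F;
    by rewrite in_cons ?eqxx //= mem_cat al ?orbT.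
have Fs t : F t ≼ s.
  by apply: F_ub => [a /(svalP t)|]; exact: ub.
have Fsup : is_sup lev (range F) s.
  split; first by move=> _ [t _ <-].
  move=> u hu; apply: lub => a Aa.
  have ha b : b \in [:: a] -> A b by rewrite inE => /eqP ->.
  apply: (@lev_trans (F (exist Q _ ha))); first by apply: le_F; rewrite !inE eqxx orbT.
  by apply: hu; eexists.
have [V [nV xV]] : carrier lev N (s - a0) by rewrite CT.
have sV n : solid_in lev setT (V n) := (nV.1 n).2.
have Fconv := leb T _ F s dirT (sup_order_conv dirT (fun _ _ h => h) Fsup).
(* The o-Lebesgue property brings some finite supremum within [V n] of [s]; the entries of these
   lists, together with [a0], form [C]. *)
have ht n : exists t, V n (s - F t).
  have [t0 ht0] := Fconv (V n) (nV.1 n).1; exists t0.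
  by rewrite -opprB; apply: solidN => //; apply: ht0; exact: lev_refl.
have [t tP] := choice ht.
pose C := \bigcup_n [set` a0 :: sval (t n)].
exists C; split.
- by move=> a [n _]; rewrite /= inE => /orP[/eqP ->|/(svalP (t n))].
- by apply: bigcup_countable => // n _; apply: finite_set_countable; exact: finite_seq.
split.
  by move=> a [n _]; rewrite /= inE => /orP[/eqP ->|/(svalP (t n))]; exact: ub.
move=> u hu; have Ca0 : C a0 by exists 0%N => //=; exact: mem_head.
(* The positive part of s - u is below every [s - F (t n)], hence in every [V n]. It is also below s
   - a0, which is disjoint from the intersection of [V], so it is disjoint from itself. *)
suff h0 : vjoin (s - u) 0 = 0.
  by rewrite -[u]addr0 addrC -lev_subl_addr -h0; exact: lev_joinl.
have uF n : F (t n) ≼ u.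
  by apply: F_ub => [a al|]; apply: hu => //; exists n => //=; rewrite in_cons al orbT.
have p0 : 0 ≼ vjoin (s - u) 0 by exact: lev_joinr.
apply: disj_self; apply: (@disj_le (s - a0)).
  apply: xV => n /=; apply: (sV n).2 (tP n) _ _ => //.
  rewrite (absv_id p0) absv_id ?lev_subr_ge0 //.
  by apply: vjoin_le; rewrite ?lev_subr_ge0 //; apply: levD => //; rewrite lev_opp2.
rewrite (absv_id p0); apply: lev_trans (lev_abs _).
apply: vjoin_le; last by rewrite lev_subr_ge0; exact: ub.
by apply: levD => //; rewrite lev_opp2; exact: hu.
Qed.

End VectorLattice.

(** * Transfer of the carrier to and from the Dedekind completion *)

Section DedekindCompletion.
Local Open Scope ring_scope.
Variables (R : realType) (E F : lmodType R).
Variables (lev : E -> E -> Prop) (levF : F -> F -> Prop) (j : E -> F).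
Hypothesis hE : vector_lattice lev.
Hypothesis hF : vector_lattice levF.
Hypothesis hj : dedekind_completion lev levF j.

Lemma completionD x y : j (x + y) = j x + j y.
Proof. by case: hj => [_ [jlin _]]; have := jlin 1 x y; rewrite !scale1r. Qed.

Lemma completion0 : j 0 = 0.
Proof. by apply: (@addrI _ (j 0)); rewrite -completionD !addr0. Qed.

Lemma completionN x : j (- x) = - j x.
Proof. by apply: (@addrI _ (j x)); rewrite -completionD !subrr completion0. Qed.

Lemma completion_le x y : lev x y <-> levF (j x) (j y).
Proof. by case: hj => [_ [_ [_ []]]]. Qed.

Lemma completion_abs x : absv levF (j x) = j (absv lev x).
Proof.
have [_ [_ [_ [_ [jsup _]]]]] := hj.
apply: (is_sup_unique hF (absvP hF (j x))).
by rewrite -completionN; apply/jsup/absvP.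
Qed.

Lemma completion_preim_solid V :
  solid_in levF setT V -> solid_in lev setT (j @^-1` V).
Proof.
move=> [_ sV]; split=> // x y Vx _ yx; apply: sV Vx _ _ => //.
by rewrite !completion_abs; apply/completion_le.
Qed.

Lemma completion_disj x y : disj levF (j x) (j y) -> disj lev x y.
Proof.
move=> /(disjP hF) d; apply/(disjP hE) => u /completion_le ux /completion_le uy.
by apply/completion_le; rewrite completion0; apply: d; rewrite completion_abs.
Qed.

Variables (N : set (set E)) (Nd : set (set F)).
Hypothesis hNd : locally_solid levF Nd.
Hypothesis hext : extends_top j N Nd.

Lemma carrier_completion_preim x : carrier levF Nd (j x) -> carrier lev N x.
Proof.
move=> [V [[NV VD] xV]]; exists (fun n => j @^-1` V n); split; last first.
  by move=> y Vy; apply: completion_disj; exact: xV.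
split=> [n|n a b Va Vb]; last by rewrite /= completionD; exact: VD.
have [NVn sVn] := NV n; split; last exact: completion_preim_solid.
by apply/hext; exists (V n); split.
Qed.

(* An element of [F] below [j x] and in the kernel of [W] would dominate some
   [j y > 0], with [y] both below [x] and in the kernel of [V]. *)
Lemma carrier_completion x : carrier lev N x -> carrier levF Nd (j x).
Proof.
move=> [V [[NV VD] xV]]; have [_ [_ [_ [_ [_ [dense _]]]]]] := hj.
have hW n : exists W, Nd W /\ j @^-1` W `<=` V n.
  by have [W] := (hext (V n)).1 (NV n).1; exists W.
have [W' W'P] := choice hW.
have [W [nW WW']] := exists_normal_solid_seq hNd (fun n => (W'P n).1).
exists W; split=> // f Wf; apply/(disjP hF) => u ux uf.
pose v := vjoin levF u 0; have v0 : levF 0 v by exact: (lev_joinr hF).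
have vf : levF v (absv levF f) by apply: (vjoin_le hF) => //; exact: absv_ge0.
have vx : levF v (absv levF (j x)) by apply: (vjoin_le hF) => //; exact: absv_ge0.
suff <- : v = 0 by exact: (lev_joinl hF).
apply: contrapT => vn0; have [y [jy0 jyn0 jyv]] := dense v v0 vn0.
have y0 : lev 0 y by apply/completion_le; rewrite completion0.
apply: jyn0; rewrite -completion0; congr j; apply: (disj_self hE).
apply: (disj_le hE (x := x)); last first.
  apply/completion_le; rewrite (absv_id hE y0) -completion_abs.
  exact: (lev_trans hF) vx.
apply: xV => n /=; apply: (W'P n).2; apply: WW'.
have [_ [_ sW]] := nW.1 n; apply: sW (Wf n) _ _ => //.
by rewrite (absv_id hF jy0); exact: (lev_trans hF) vf.
Qed.

(** For the passage to [F]: each |f| lies below some [j y], and the carrier is solid. *)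
Lemma carrier_completion_setT : carrier lev N = setT <-> carrier levF Nd = setT.
Proof.
split=> CT; apply/seteqP; split=> // x _; last first.
  by apply: carrier_completion_preim; rewrite CT.
have [_ [_ [_ [_ [_ [_ major]]]]]] := hj.
have [y fy] := major (absv levF x).
have : carrier levF Nd (j y) by apply: carrier_completion; rewrite CT.
move=> /(carrier_solid hF Nd).2; apply=> //.
exact: (lev_trans hF) fy (lev_abs hF _).
Qed.

End DedekindCompletion.

(** * Assembly of the equivalences around the carrier *)

Lemma submetrisable_carrier (R : realType) (E : lmodType R) (lev : E -> E -> Prop)
    (N : set (set E)) :
  vector_lattice lev -> locally_solid lev N ->
  locally_solidly_submetrisable lev N <-> carrier lev N = setT.
Proof.
move=> hE hN; split=> [h|CT x]; last first.
  by apply/(submetrisable_band_carrier hE hN); rewrite CT.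
by apply/seteqP; split=> // x _; exact/(submetrisable_band_carrier hE hN).
Qed.

Lemma interval_complete_submetrisable (R : realType) (E : lmodType R)
    (lev : E -> E -> Prop) (N : set (set E)) :
  vector_lattice lev ->
  locally_interval_complete_solidly_submetrisable lev N ->
  locally_solidly_submetrisable lev N.
Proof.
move=> hE h x; have [M [? ? ? _]] := h _ (absv_ge0 hE x).
by rewrite -(band_absv hE); exists M.
Qed.

Theorem theorem3p11 (R : realType) (E : lmodType R) (lev : E -> E -> Prop)
  (hE : vector_lattice lev) (N : set (set E)) (hN : fatou lev N)
  (F : lmodType R) (levF : F -> F -> Prop) (hF : vector_lattice levF)
  (j : E -> F) (hj : dedekind_completion lev levF j)
  (Nd : set (set F)) (hNd : fatou levF Nd) (hext : extends_top j N Nd) :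
  (locally_solidly_submetrisable lev N <-> locally_solidly_submetrisable levF Nd) /\
  (locally_solidly_submetrisable lev N <->
     locally_interval_complete_solidly_submetrisable levF Nd) /\
  (locally_solidly_submetrisable lev N <-> carrier lev N = setT) /\
  (locally_solidly_submetrisable lev N <-> carrier levF Nd = setT) /\
  (o_lebesgue lev N ->
     (locally_solidly_submetrisable lev N <-> countable_sup_property lev)).
Proof.
have carE := submetrisable_carrier hE hN.1.
have carF := submetrisable_carrier hF hNd.1.
have carEF := carrier_completion_setT hE hF hj hNd.1 hext.
split; first by rewrite carE carF.
split.
  split=> [/carE/carEF CT x x0|/(interval_complete_submetrisable hF)].
    by apply: (carrier_interval_complete hF hNd hj.1 x0); rewrite CT.
  by rewrite carF carE carEF.
split; first exact: carE.
split; first by rewrite carE.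
move=> leb; rewrite carE; split; first exact: carrier_csp.
exact: csp_carrier.
Qed.
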